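(* Let $S\in\mathcal S_d(\mathcal U,\mathcal Y)$. Any observable weakly coisometric realization of $S$ is unitarily equivalent to some generalized functional-model realization of $S$.
   Context: $\mathcal U,\mathcal Y,\mathcal X$ are Hilbert spaces and $\mathcal L(\cdot,\cdot)$ denotes bounded linear operators. $\mathbb B^d$ is the open unit ball of $\mathbb C^d$ with inner product $\langle\lambda,\zeta\rangle=\sum_j\lambda_j\overline{\zeta_j}$; $\mathcal H(k_d)$ is the reproducing kernel Hilbert space on $\mathbb B^d$ with kernel $k_d(\lambda,\zeta)=1/(1-\langle\lambda,\zeta\rangle)$ and $\mathcal H_{\mathcal Y}(k_d)=\mathcal H(k_d)\otimes\mathcal Y$, viewed as a space of $\mathcal Y$-valued functions. $\mathcal S_d(\mathcal U,\mathcal Y)$ is the set of $\mathcal L(\mathcal U,\mathcal Y)$-valued analytic functions $S$ on $\mathbb B^d$ such that $f\mapsto S f$ is a contraction from $\mathcal H_{\mathcal U}(k_d)$ into $\mathcal H_{\mathcal Y}(k_d)$. For such $S$, $K_S(\lambda,\zeta)=\dfrac{I_{\mathcal Y}-S(\lambda)S(\zeta)^*}{1-\langle\lambda,\zeta\rangle}$ is a positive kernel on $\mathbb B^d$, and $\mathcal H(K_S)$ is the reproducing kernel Hilbert space of $\mathcal Y$-valued functions with kernel $K_S$. Realizations: for $\mathbf A=(A_1,\dots,A_d)\in\mathcal L(\mathcal X)^d$ and $B_1,\dots,B_d\in\mathcal L(\mathcal U,\mathcal X)$, $A:\mathcal X\to\mathcal X^d$ and $B:\mathcal U\to\mathcal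 X^d$ are the columns with entries $A_j$ and $B_j$, and $Z(\lambda)=[\lambda_1I_{\mathcal X}\ \cdots\ \lambda_dI_{\mathcal X}]:\mathcal X^d\to\mathcal X$. A realization of $S$ with state space $\mathcal X$ is given by $\mathbf U=\begin{bmatrix}A&B\\ C&D\end{bmatrix}:\mathcal X\oplus\mathcal U\to\mathcal X^d\oplus\mathcal Y$ with $S(\lambda)=D+C(I-Z(\lambda)A)^{-1}Z(\lambda)B$ on $\mathbb B^d$. It is weakly coisometric if $\mathbf U^*$ is contractive and is isometric on $\mathcal D\oplus\mathcal Y$, where $\mathcal D=\overline{\operatorname{span}}\{Z(\zeta)^*(I-A^*Z(\zeta)^* )^{-1}C^*y:\zeta\in\mathbb B^d,\ y\in\mathcal Y\}\subset\mathcal X^d$. It is observable if $C(I-\lambda_1A_1-\cdots-\lambda_dA_d)^{-1}x=0$ for all $\lambda\in\mathbb B^d$ implies $x=0$. Generalized functional-model realization: a weakly coisometric realization of $S$ with state space $\mathcal X=\mathcal H(K_S)$, with $C:\mathcal H(K_S)\to\mathcal Y$ given by $Cf=f(0)$, and with $A_1,\dots,A_d$ a contractive solution of the Gleason problem for $\mathcal H(K_S)$, i.e. for every $f\in\mathcal H(K_S)$: $f(\lambda)-f(0)=\sum_{j=1}^d\lambda_j(A_jf)(\lambda)$ for $\lambda\in\mathbb B^d$, and $\sum_{j=1}^d\|A_jf\|^2\le\|f\|^2-\|f(0)\|^2_{\mathcal Y}$. Unitary equivalence: $\mathbf U=\begin{bmatrix}A&B\\ C&D\end{bmatrix}:\mathcal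 X\oplus\mathcal U\to\mathcal X^d\oplus\mathcal Y$ and $\widetilde{\mathbf U}=\begin{bmatrix}\widetilde A&\widetilde B\\ \widetilde C&\widetilde D\end{bmatrix}:\widetilde{\mathcal X}\oplus\mathcal U\to\widetilde{\mathcal X}^d\oplus\mathcal Y$ are unitarily equivalent if there is a unitary $U:\mathcal X\to\widetilde{\mathcal X}$ with $$\begin{bmatrix}\oplus_{k=1}^dU&0\\ 0&I_{\mathcal Y}\end{bmatrix}\begin{bmatrix}A&B\\ C&D\end{bmatrix}=\begin{bmatrix}\widetilde A&\widetilde B\\ \widetilde C&\widetilde D\end{bmatrix}\begin{bmatrix}U&0\\ 0&I_{\mathcal U}\end{bmatrix}.$$ *)

(* Defs.v *)
From HB Require Import structures.
From mathcomp Require Import all_boot all_order all_algebra.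
From mathcomp Require Import complex.
From mathcomp Require Import all_classical all_reals.
From mathcomp Require Import topology normedtype.
From mathcomp Require Import ring lra.

Set Implicit Arguments.
Unset Strict Implicit.
Unset Printing Implicit Defensive.

Import Order.TTheory GRing.Theory Num.Theory.
Import numFieldNormedType.Exports.

Local Open Scope classical_set_scope.
Local Open Scope ring_scope.

(* The inner product is linear in its first argument. *)
HB.mixin Record NormedModule_hasDot (R : realType) V & NormedModule R[i] V := {
  dotp : V -> V -> R[i];
  dotpDl : forall x y z, dotp (x + y) z = dotp x z + dotp y z;
  dotpZl : forall a x y, dotp (a *: x) y = a * dotp x y;
  dotpC : forall x y, dotp x y = (dotp y x)^*;
  dotp_norm : forall x, dotp x x = `|x| ^+ 2
}.

#[short(type="preHilbertType")]
HB.structure Definition PreHilbert (R : realType) :=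
  {V of NormedModule R[i] V & NormedModule_hasDot R V}.

#[short(type="hilbertType")]
HB.structure Definition Hilbert (R : realType) :=
  {V of PreHilbert R V & Complete V}.

HB.factory Record Lmodule_hasDot (R : realType) V & GRing.Lmodule R[i] V := {
  dotp : V -> V -> R[i];
  dotpDl : forall x y z, dotp (x + y) z = dotp x z + dotp y z;
  dotpZl : forall a x y, dotp (a *: x) y = a * dotp x y;
  dotpC : forall x y, dotp x y = (dotp y x)^*;
  dotp_ge0 : forall x, 0 <= dotp x x;
  dotp_eq0 : forall x, dotp x x = 0 -> x = 0
}.

HB.builders Context R V & Lmodule_hasDot R V.

Let nrm (x : V) : R[i] := sqrtC (dotp x x).

Let dotpDr x y z : dotp x (y + z) = dotp x y + dotp x z.
Proof. by rewrite dotpC dotpDl rmorphD /= -!dotpC. Qed.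

Let dotpZr a x y : dotp x (a *: y) = a^* * dotp x y.
Proof. by rewrite dotpC dotpZl rmorphM /= -dotpC. Qed.

Let nrm_ge0 x : 0 <= nrm x. Proof. by rewrite sqrtC_ge0 dotp_ge0. Qed.

Let nrmZ a x : nrm (a *: x) = `|a| * nrm x.
Proof.
by rewrite /nrm dotpZl dotpZr mulrA -normCK rootCMl ?exprn_ge0// sqrCK.
Qed.

Let nrm_eq0 x : nrm x = 0 -> x = 0.
Proof. by move/eqP; rewrite sqrtC_eq0 => /eqP/dotp_eq0. Qed.

Let CS x y : `|dotp x y| <= nrm x * nrm y.
Proof.
have [y0|y0] := eqVneq (dotp y y) 0.
  by rewrite (dotp_eq0 y0) -(scale0r (0 : V)) dotpZr nrmZ conjC0 normr0 !mul0r
             normr0 mulr0.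
have yp : 0 < dotp y y by rewrite lt_def y0 dotp_ge0.
rewrite -(@ler_pXn2r _ 2) ?nnegrE ?mulr_ge0// exprMn !sqrtCK.
set p := dotp y y in yp *; set c := dotp x y.
have pJ : p^* = p by rewrite -dotpC.
have := dotp_ge0 (x + (- (c / p)) *: y).
rewrite dotpDl !dotpDr !dotpZl !dotpZr (dotpC y x) -/c -/p rmorphN rmorphM.
rewrite fmorphV /= pJ => h; rewrite normCK -ler_pdivrMr// -subr_ge0.
congr (0 <= _): h; field; exact: lt0r_neq0.
Qed.

Let nrmD x y : nrm (x + y) <= nrm x + nrm y.
Proof.
rewrite -(@ler_pXn2r _ 2) ?nnegrE ?addr_ge0// sqrrD !sqrtCK.
rewrite dotpDl !dotpDr (dotpC y x); set c := dotp x y.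
have cr : c + c^* \is Num.real by rewrite CrealE rmorphD /= conjCK addrC.
suff h : c + c^* <= nrm x * nrm y *+ 2.
  rewrite [leRHS]addrAC [X in X <= _](_ : _ = dotp x x + dotp y y + (c + c^*)).
    by rewrite lerD2l.
  by ring.
apply: le_trans (real_ler_norm cr) _; apply: le_trans (ler_normD _ _) _.
by rewrite norm_conjC -mulr2n lerMn2r CS orbT.
Qed.

HB.instance Definition _ := Lmodule_isNormed.Build R[i] V nrmD nrmZ nrm_eq0.

Let dotp_norm x : dotp x x = `|x| ^+ 2.
Proof. by rewrite /Num.norm /= sqrtCK. Qed.

HB.instance Definition _ :=
  NormedModule_hasDot.Build R V dotpDl dotpZl dotpC dotp_norm.

HB.end.

Section HilbertTheory.
Context {R : realType} {V : preHilbertType R}.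
Implicit Types x y z : V.

Lemma dotpDr x y z : dotp x (y + z) = dotp x y + dotp x z.
Proof. by rewrite dotpC dotpDl rmorphD /= -!dotpC. Qed.

Lemma dotpZr a x y : dotp x (a *: y) = a^* * dotp x y.
Proof. by rewrite dotpC dotpZl rmorphM /= -dotpC. Qed.
End HilbertTheory.

Lemma cauchy_lip (K : numFieldType) (V W : normedModType K) (f : V -> W)
    (F : set_system V) {FF : ProperFilter F} :
  (forall x y, `|f x - f y| <= `|x - y|) -> cauchy F -> cauchy (f @ F).
Proof.
move=> fl /cauchyP Fc; apply/cauchyP => e e0.
have [x Fx] := Fc _ e0; exists (f x).
apply: (@filterS _ F _ (ball x e)) Fx => y; rewrite /= -!ball_normE /ball_ /=.
exact: le_lt_trans (fl _ _).
Qed.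

Section Scalars.
Context {R : realType}.

Let dp (x y : R[i]^o) : R[i] := x * y^*.

Let dpDl x y z : dp (x + y) z = dp x z + dp y z.
Proof. exact: mulrDl. Qed.
Let dpZl a x y : dp (a *: x) y = a * dp x y.
Proof. by rewrite /dp mulrA. Qed.
Let dpC x y : dp x y = (dp y x)^*.
Proof. by rewrite /dp rmorphM /= conjCK mulrC. Qed.
Let dp_norm x : dp x x = `|x| ^+ 2.
Proof. by rewrite normCK. Qed.
HB.instance Definition _ :=
  NormedModule_hasDot.Build R R[i]^o dpDl dpZl dpC dp_norm.

Let normc_real (x : R) : `|x%:C%C| = `|x|%:C%C.
Proof. by rewrite normc_def /= expr0n addr0 sqrtr_sqr. Qed.
Let norm_i : `|'i%C : R[i]| = 1.
Proof. by rewrite normc_def /= expr0n expr1n add0r sqrtr1. Qed.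
Let normc_ge_Im' (x : R[i]) : `|complex.Im x|%:C%C <= `|x|.
Proof.
rewrite -[complex.Im x]opprK -ReiNIm normrN.
by apply: le_trans (normc_ge_Re _) _; rewrite normrM norm_i mulr1.
Qed.

Let complete (F : set_system R[i]^o) : ProperFilter F -> cauchy F -> cvg F.
Proof.
move=> FF /cauchyP Fc.
have part (f : R[i] -> R) : {morph f : x y / x - y} ->
    (forall x, (`|f x|)%:C%C <= `|x|) -> exists a : R, f @ F --> a.
  move=> fB lef; suff /cauchy_cvg/cvg_ex[/= a] : cauchy (f @ F) by exists a.
  apply/cauchyP => e e0.
  have e0' : 0 < e%:C%C :> R[i] by rewrite ltcR.
  have [x Fx] := Fc _ e0'; exists (f x).
  apply: (@filterS _ F _ (ball x e%:C%C)) Fx => y.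
  rewrite /= -!ball_normE /ball_ /= -fB -ltcR.
  exact: le_lt_trans (lef _).
have [a Fa] : exists a : R, @complex.Re R @ F --> a.
  by apply: part => [[? ?] [? ?]|x] //; exact: normc_ge_Re.
have [b Fb] : exists b : R, @complex.Im R @ F --> b.
  by apply: part => [[? ?] [? ?]|x] //; exact: normc_ge_Im'.
apply/cvg_ex; exists (a +i* b)%C; apply/cvgrPdist_lt => e e0.
have eE : e = (complex.Re e)%:C%C by rewrite RRe_real// gtr0_real.
have e20 : 0 < complex.Re e / 2 by rewrite divr_gt0// -ltcR -eE.
have /cvgrPdist_lt/(_ _ e20) Ha := Fa.
have /cvgrPdist_lt/(_ _ e20) Hb := Fb.
near=> z.
have na : `|a - complex.Re z| < complex.Re e / 2 by near: z.
have nb : `|b - complex.Im z| < complex.Re e / 2 by near: z.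
rewrite (_ : _ - z = (a - complex.Re z)%:C%C +
   'i%C * (b - complex.Im z)%:C%C); last first.
  by rewrite [X in _ - X]complexE [(a +i* b)%C]complexE /=; ring.
apply: le_lt_trans (ler_normD _ _) _; rewrite normrM !normc_real.
rewrite norm_i mul1r -rmorphD eE ltcR; lra.
Unshelve. all: by end_near.
Qed.
HB.instance Definition _ := Uniform_isComplete.Build R[i]^o complete.

End Scalars.

Section DirectSum.
Context {R : realType}.
Variables X U : hilbertType R.

(* An alias, so that the norm is the Hilbert one and not the maximum norm of
   the product. *)
Definition dsum : Type := (X * U)%type.
HB.instance Definition _ := GRing.Lmodule.copy dsum (X * U)%type.

Let dp (v w : dsum) : R[i] := dotp v.1 w.1 + dotp v.2 w.2.

Let dpDl x y z : dp (x + y) z = dp x z + dp y z.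
Proof. by rewrite /dp !dotpDl addrACA. Qed.
Let dpZl a x y : dp (a *: x) y = a * dp x y.
Proof. by rewrite /dp !dotpZl mulrDr. Qed.
Let dpC x y : dp x y = (dp y x)^*.
Proof. by rewrite /dp rmorphD /= -!dotpC. Qed.
Let dp_ge0 x : 0 <= dp x x.
Proof. by rewrite /dp !dotp_norm addr_ge0 ?exprn_ge0. Qed.
Let dp_eq0 x : dp x x = 0 -> x = 0.
Proof.
rewrite /dp !dotp_norm => /eqP; rewrite paddr_eq0 ?exprn_ge0// !sqrf_eq0.
by rewrite !normr_eq0; case: x => [a b] /= /andP[/eqP-> /eqP->].
Qed.
HB.instance Definition _ :=
  Lmodule_hasDot.Build R dsum dpDl dpZl dpC dp_ge0 dp_eq0.

Lemma dsum_dotE (v w : dsum) : dotp v w = dotp v.1 w.1 + dotp v.2 w.2.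
Proof. by []. Qed.

Lemma dsum_normE (v : dsum) : `|v| ^+ 2 = `|v.1| ^+ 2 + `|v.2| ^+ 2.
Proof. by rewrite -!dotp_norm. Qed.

Let complete (F : set_system dsum) : ProperFilter F -> cauchy F -> cvg F.
Proof.
move=> FF Fc.
have le1 (v : dsum) : `|v.1| <= `|v|.
  by rewrite -(@ler_pXn2r _ 2) ?nnegrE// dsum_normE lerDl exprn_ge0.
have le2 (v : dsum) : `|v.2| <= `|v|.
  by rewrite -(@ler_pXn2r _ 2) ?nnegrE// dsum_normE lerDr exprn_ge0.
have /cauchy_cvg/cvg_ex[/= a Fa] : cauchy ((fun v : dsum => v.1) @ F).
  by apply: cauchy_lip => // x y; exact: (le1 (x - y)).
have /cauchy_cvg/cvg_ex[/= b Fb] : cauchy ((fun v : dsum => v.2) @ F).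
  by apply: cauchy_lip => // x y; exact: (le2 (x - y)).
apply/cvg_ex; exists ((a, b) : dsum); apply/cvgrPdist_lt => e e0.
have e20 : 0 < e / 2 by rewrite divr_gt0.
have /cvgrPdist_lt/(_ _ e20) Ha := Fa.
have /cvgrPdist_lt/(_ _ e20) Hb := Fb.
near=> v.
have na : `|a - v.1| < e / 2 by near: v.
have nb : `|b - v.2| < e / 2 by near: v.
apply: (@le_lt_trans _ _ (`|a - v.1| + `|b - v.2|)); last first.
  by rewrite [ltRHS]splitr ltrD.
rewrite -(@ler_pXn2r _ 2) ?nnegrE ?addr_ge0// dsum_normE sqrrD /=.
by rewrite addrAC lerDl mulrn_wge0// mulr_ge0.
Unshelve. all: by end_near.
Qed.
HB.instance Definition _ := Uniform_isComplete.Build dsum complete.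

End DirectSum.

Section DirectPower.
Context {R : realType}.
Variables (d : nat) (X : hilbertType R).

Definition dpow : Type := {ffun 'I_d -> X}.
HB.instance Definition _ := GRing.Lmodule.copy dpow {ffun 'I_d -> X}.

Let dp (v w : dpow) : R[i] := \sum_j dotp (v j) (w j).

Let dpDl x y z : dp (x + y) z = dp x z + dp y z.
Proof. by rewrite -big_split; apply: eq_bigr => j _; rewrite ffunE dotpDl. Qed.
Let dpZl a x y : dp (a *: x) y = a * dp x y.
Proof. by rewrite mulr_sumr; apply: eq_bigr => j _; rewrite ffunE dotpZl. Qed.
Let dpC x y : dp x y = (dp y x)^*.
Proof. by rewrite rmorph_sum; apply: eq_bigr => j _; exact: dotpC. Qed.
Let dp_ge0 x : 0 <= dp x x.
Proof. by apply: sumr_ge0 => j _; rewrite dotp_norm exprn_ge0. Qed.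
Let dp_eq0 x : dp x x = 0 -> x = 0.
Proof.
move=> /eqP; rewrite psumr_eq0 => [/allP h|j _]; last by rewrite dotp_norm exprn_ge0.
apply/ffunP => j; have := h j; rewrite mem_index_enum ffunE => /(_ isT) /=.
by rewrite dotp_norm sqrf_eq0 normr_eq0 => /eqP.
Qed.
HB.instance Definition _ :=
  Lmodule_hasDot.Build R dpow dpDl dpZl dpC dp_ge0 dp_eq0.

Lemma dpow_dotE (v w : dpow) : dotp v w = \sum_j dotp (v j) (w j).
Proof. by []. Qed.

Lemma dpow_normE (v : dpow) : `|v| ^+ 2 = \sum_j `|v j| ^+ 2.
Proof. by rewrite -dotp_norm; apply: eq_bigr => j _; rewrite dotp_norm. Qed.

Let complete (F : set_system dpow) : ProperFilter F -> cauchy F -> cvg F.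
Proof.
move=> FF Fc.
have lej (v : dpow) j : `|v j| <= `|v|.
  rewrite -(@ler_pXn2r _ 2) ?nnegrE// dpow_normE (bigD1 j)//= lerDl.
  by apply: sumr_ge0 => k _; rewrite exprn_ge0.
have cF j : exists a : X, (fun v : dpow => v j) @ F --> a.
  have /cauchy_cvg/cvg_ex[/= a Fa] : cauchy ((fun v : dpow => v j) @ F).
    by apply: cauchy_lip => // x y; have := lej (x - y) j; rewrite !ffunE.
  by exists a.
have [a Fa] := choice cF.
apply/cvg_ex; exists ([ffun j => a j] : dpow); apply/cvgrPdist_lt => e e0.
pose e' := e / (d%:R + 1).
have d0 : 0 < d%:R + 1 :> R[i] by rewrite ltr_wpDl.
have e'0 : 0 < e' by rewrite divr_gt0.
have H j : \forall v \near F, `|a j - (v : dpow) j| < e'.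
  by have /cvgrPdist_lt/(_ _ e'0) := Fa j.
have {}H : \forall v \near F, forall j, `|a j - (v : dpow) j| < e'.
  exact: filter_forall.
near=> v.
have nv : forall j, `|a j - v j| < e' by near: v.
have le_sum : `|([ffun j => a j] : dpow) - v| <= \sum_j `|a j - v j|.
  rewrite -(@ler_pXn2r _ 2) ?nnegrE ?sumr_ge0// dpow_normE.
  rewrite [leRHS]expr2 mulr_suml; apply: ler_sum => j _.
  rewrite !ffunE expr2 ler_wpM2l// (bigD1 j)//= lerDl.
  exact: sumr_ge0.
apply: (le_lt_trans le_sum).
apply: (@le_lt_trans _ _ (d%:R * e')).
  rewrite -[X in X%:R](card_ord d) -sumr_const mulr_suml.
  by apply: ler_sum => j _; rewrite mul1r ltW.
rewrite /e' mulrCA -[ltRHS]mulr1 ltr_pM2l// ltr_pdivrMr// mul1r.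
by rewrite ltrDl.
Unshelve. all: by end_near.
Qed.
HB.instance Definition _ := Uniform_isComplete.Build dpow complete.

End DirectPower.

Record bop (R : realType) (X Y : hilbertType R) := BOp {
  bop_fun :> {linear X -> Y};
  bop_cont : continuous bop_fun }.

Section Operators.
Context {R : realType}.

(* [adjoint] and [opinv] are chosen values: Riesz representation provides the
   adjoint of a bounded operator, and [opinv] is only meaningful on bijections
   (see [invertible]). *)
Definition adjoint (X Y : hilbertType R) (T : X -> Y) (y : Y) : X :=
  xget 0 [set x | forall z, dotp (T z) y = dotp z x].

Definition opinv (X Y : hilbertType R) (T : X -> Y) (y : Y) : X :=
  xget 0 [set x | T x = y].

Definition invertible (X Y : hilbertType R) (T : X -> Y) : Prop :=
  exists T' : bop Y X, cancel T T' /\ cancel T' T.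

Definition contractive (X Y : hilbertType R) (T : X -> Y) : Prop :=
  forall x, `|T x| <= `|x|.

Definition unitary (X Y : hilbertType R) (T : X -> Y) : Prop :=
  (forall x x', dotp (T x) (T x') = dotp x x') /\ (forall y, exists x, T x = y).

Definition span (X : hilbertType R) (A : set X) : set X :=
  [set x | exists n (c : 'I_n -> R[i]) (a : 'I_n -> X),
     (forall i, A (a i)) /\ x = \sum_(i < n) c i *: a i].

Definition closed_span (X : hilbertType R) (A : set X) : set X :=
  closure (span A).

Definition dsum_map (X X' U U' : hilbertType R) (f : X -> X') (g : U -> U')
  (v : dsum X U) : dsum X' U' := (f v.1, g v.2).

Definition dpow_map (d : nat) (X X' : hilbertType R) (f : X -> X')
  (v : dpow d X) : dpow d X' := [ffun j => f (v j)].

End Operators.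

Section UnitBall.
Context {R : realType} {d : nat}.

Definition cdot (l z : 'rV[R[i]]_d) : R[i] := \sum_(j < d) l 0 j * (z 0 j)^*.

Definition cball := {l : 'rV[R[i]]_d | cdot l l < 1}.

Fact cball0_subproof : cdot (0 : 'rV[R[i]]_d) 0 < 1.
Proof. by rewrite /cdot big1 // => j _; rewrite mxE mul0r. Qed.

Definition cball0 : cball := exist _ 0 cball0_subproof.

End UnitBall.
Arguments cball R d : clear implicits.

(* A reproducing kernel Hilbert space with kernel [K] is represented by a
   Hilbert space whose vectors are faithfully identified, through [rk_eval],
   with [Y]-valued functions on [Om]. It is unique up to the unitary that
   intertwines the evaluations. *)
Record rkhs (R : realType) (Om : Type) (Y : hilbertType R)
    (K : Om -> Om -> Y -> Y) := Rkhs {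
  rk_space :> hilbertType R;
  rk_eval : rk_space -> Om -> Y;
  rk_evalP : forall a f g w,
    rk_eval (a *: f + g) w = a *: rk_eval f w + rk_eval g w;
  rk_eval_inj : injective rk_eval;
  rk_kernel : forall z y, exists k : rk_space,
    (forall w, rk_eval k w = K w z y) /\
    (forall f, dotp f k = dotp (rk_eval f z) y) }.

(* The Hilbert tensor product of a scalar reproducing kernel Hilbert space with
   [Y]; the function attached to [f (x) y] is [w |-> f(w) y], and evaluation
   at a point extends by continuity. *)
Record tensor_fun (R : realType) (Om : Type)
    (K : Om -> Om -> R[i]^o -> R[i]^o) (H : rkhs K) (Y : hilbertType R) :=
    TensorFun {
  tf_space :> hilbertType R;
  tf_pure : H -> Y -> tf_space;
  tf_dot : forall f g y z,
    dotp (tf_pure f y) (tf_pure g z) = dotp f g * dotp y z;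
  tf_dense : closed_span [set t | exists f y, t = tf_pure f y] = setT;
  tf_eval : Om -> bop tf_space Y;
  tf_evalE : forall w f y, tf_eval w (tf_pure f y) = rk_eval f w *: y }.

Section Schur.
Context {R : realType} {d : nat}.

Definition kd (l z : cball R d) (c : R[i]^o) : R[i]^o :=
  (1 - cdot (val l) (val z))^-1 *: c.

Context {U Y : hilbertType R}.
Implicit Types S : cball R d -> bop U Y.

(* Complex Frechet differentiability for the operator norm; the norm used on
   'rV is the maximum norm, equivalent to the Euclidean one. *)
Definition analytic S : Prop :=
  forall l0 : cball R d, exists T : 'I_d -> bop U Y,
  forall e : R[i], 0 < e -> exists2 r : R[i], 0 < r &
  forall l : cball R d, `|val l - val l0| < r ->
  forall u, `|S l u - S l0 u - \sum_(j < d) (val l - val l0) 0 j *: T j u|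
            <= e * `|val l - val l0| * `|u|.

Definition contractive_multiplier S : Prop :=
  forall (H : rkhs kd) (HU : tensor_fun H U) (HY : tensor_fun H Y) (f : HU),
  exists g : HY, (forall l, tf_eval HY l g = S l (tf_eval HU l f)) /\
                 `|g| <= `|f|.

Definition schur_class S : Prop := analytic S /\ contractive_multiplier S.

Definition KS S (l z : cball R d) (y : Y) : Y :=
  (1 - cdot (val l) (val z))^-1 *: (y - S l (adjoint (S z) y)).

End Schur.

Record colligation (R : realType) (d : nat) (X U Y : hilbertType R) :=
    Colligation {
  colA : 'I_d -> bop X X;
  colB : 'I_d -> bop U X;
  colC : bop X Y;
  colD : bop U Y }.

Section Realization.
Context {R : realType} {d : nat} {X U Y : hilbertType R}.
Implicit Types (c : colligation d X U Y) (l : cball R d)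
  (S : cball R d -> bop U Y).

Definition opA c (x : X) : dpow d X := [ffun j => colA c j x].
Definition opB c (u : U) : dpow d X := [ffun j => colB c j u].

Definition opU c (v : dsum X U) : dsum (dpow d X) Y :=
  (opA c v.1 + opB c v.2, colC c v.1 + colD c v.2).

Definition opZ l (v : dpow d X) : X := \sum_(j < d) val l 0 j *: v j.

(* I - Z(l) A = I - l_1 A_1 - ... - l_d A_d *)
Definition pencil c l (x : X) : X := x - opZ l (opA c x).

Definition realizes c S : Prop :=
  forall l, invertible (pencil c l) /\
  forall u, S l u = colD c u + colC c (opinv (pencil c l) (opZ l (opB c u))).

Definition defect_space c : set (dpow d X) :=
  closed_span [set v | exists (z : cball R d) (y : Y),
    v = adjoint (opZ z)
          (opinv (fun x => x - adjoint (opA c) (adjoint (opZ z) x))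
                 (adjoint (colC c) y))].

Definition weakly_coisometric c : Prop :=
  contractive (adjoint (opU c)) /\
  (forall v y, defect_space c v ->
     `|adjoint (opU c) ((v, y) : dsum (dpow d X) Y)| =
     `|(v, y) : dsum (dpow d X) Y|).

Definition observable c : Prop :=
  forall x, (forall l, colC c (opinv (pencil c l) x) = 0) -> x = 0.

End Realization.

Section FunctionalModel.
Context {R : realType} {d : nat} {U Y : hilbertType R}.
Variable S : cball R d -> bop U Y.

Definition gleason_solution (H : rkhs (KS S)) (A : 'I_d -> bop H H) : Prop :=
  forall f : H,
    (forall l, rk_eval f l - rk_eval f cball0 =
               \sum_(j < d) val l 0 j *: rk_eval (A j f) l) /\
    \sum_(j < d) `|A j f| ^+ 2 <= `|f| ^+ 2 - `|rk_eval f cball0| ^+ 2.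

Definition gen_functional_model (H : rkhs (KS S)) (c : colligation d H U Y) :=
  [/\ realizes c S, weakly_coisometric c,
      forall f, colC c f = rk_eval f cball0 & gleason_solution (colA c)].

End FunctionalModel.

Definition unitarily_equivalent (R : realType) (d : nat)
    (X X' U Y : hilbertType R) (c : colligation d X U Y)
    (c' : colligation d X' U Y) : Prop :=
  exists V : bop X X', unitary V /\
  forall v : dsum X U,
    dsum_map (dpow_map V) idfun (opU c v) = opU c' (dsum_map V idfun v).

(* Main.v *)
(* For a realization of [S], write [C (I - Z(l) A)^-1 x] for the value at [l] of
   the function attached to the state [x], and let [g_(l,y)] be the state with
   [<C (I - Z(l) A)^-1 x, y> = <x, g_(l,y)>].  The adjoint of the colligation
   sends [(Z(l)^* g_(l,y), y)] to [(g_(l,y), S(l)^* y)], so weak coisometry gives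
   [(1 - <w, z>) <g_(z,y), g_(w,y')> = <y, y'> - <S(z)^* y, S(w)^* y'>]: the
   [g_(l,y)] have the same Gram matrix as the kernel functions of [H(K_S)].
   Observability says that they are total, hence they correspond to the kernel
   functions under a unitary, which maps [x] to [l |-> C (I - Z(l) A)^-1 x], and
   the colligation transported along it is the functional model. *)
Require Import Defs.
From HB Require Import structures.
From mathcomp Require Import all_boot all_order all_algebra.
From mathcomp Require Import complex.
From mathcomp Require Import all_classical all_reals.
From mathcomp Require Import topology normedtype.
From mathcomp Require Import ring lra.

Set Implicit Arguments.
Unset Strict Implicit.
Unset Printing Implicit Defensive.

Import Order.TTheory GRing.Theory Num.Theory.
Import numFieldNormedType.Exports.

Local Open Scope classical_set_scope.
Local Open Scope ring_scope.

(** * Inner product identities, Cauchy-Schwarz and continuity of the inner product *)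

Section InnerProduct.
Context {R : realType} {V : preHilbertType R}.
Implicit Types (x y z : V) (a : R[i]).

Lemma dotp0l x : dotp 0 x = 0.
Proof. by rewrite -(scale0r (0 : V)) dotpZl mul0r. Qed.

Lemma dotp0r x : dotp x 0 = 0.
Proof. by rewrite dotpC dotp0l rmorph0. Qed.

Lemma dotpNl x y : dotp (- x) y = - dotp x y.
Proof. by rewrite -scaleN1r dotpZl mulN1r. Qed.

Lemma dotpNr x y : dotp x (- y) = - dotp x y.
Proof. by rewrite dotpC dotpNl rmorphN /= -dotpC. Qed.

Lemma dotpBl x y z : dotp (x - y) z = dotp x z - dotp y z.
Proof. by rewrite dotpDl dotpNl. Qed.

Lemma dotpBr x y z : dotp x (y - z) = dotp x y - dotp x z.
Proof. by rewrite dotpDr dotpNr. Qed.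

Lemma dotp_suml (I : finType) (F : I -> V) y :
  dotp (\sum_i F i) y = \sum_i dotp (F i) y.
Proof. exact: (big_morph (dotp^~ y) (fun u v => dotpDl u v y) (dotp0l y)). Qed.

Lemma dotp_sumr (I : finType) (F : I -> V) y :
  dotp y (\sum_i F i) = \sum_i dotp y (F i).
Proof. exact: (big_morph (dotp y) (dotpDr y) (dotp0r y)). Qed.

Lemma dotp_eq0 x : dotp x x = 0 -> x = 0.
Proof. by rewrite dotp_norm => /eqP; rewrite sqrf_eq0 normr_eq0 => /eqP. Qed.

Lemma dotpl_inj x y : (forall z, dotp x z = dotp y z) -> x = y.
Proof. by move=> h; apply/subr0_eq/dotp_eq0; rewrite dotpBl h subrr. Qed.

Lemma dotpr_inj x y : (forall z, dotp z x = dotp z y) -> x = y.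
Proof. by move=> h; apply: dotpl_inj => z; rewrite dotpC h -dotpC. Qed.

(** The subtracted multiple of [y] is the projection of [x] on the line of [y]. The formula yields
    Cauchy-Schwarz and, in [projection], the gain from the best correction of a near-minimizer. *)
Lemma norm_subZ_proj x y : y != 0 ->
  `|x - (dotp x y / `|y| ^+ 2) *: y| ^+ 2 =
  `|x| ^+ 2 - `|dotp x y| ^+ 2 / `|y| ^+ 2.
Proof.
move=> y0; have p0 : `|y| ^+ 2 != 0 by rewrite sqrf_eq0 normr_eq0.
rewrite -dotp_norm dotpBl !dotpBr !dotpZl !dotpZr !dotp_norm (dotpC y x).
set c := dotp x y; set p := `|y| ^+ 2 in p0 *.
have pJ : p^* = p by rewrite /p -dotp_norm -dotpC.
by rewrite rmorphM /= fmorphV /= pJ (normCK c); field.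
Qed.

Lemma cauchy_schwarz x y : `|dotp x y| <= `|x| * `|y|.
Proof.
have [->|y0] := eqVneq y 0; first by rewrite dotp0r normr0 mulr_ge0.
have p0 : 0 < `|y| ^+ 2 by rewrite exprn_gt0// normr_gt0.
rewrite -(@ler_pXn2r _ 2) ?nnegrE ?mulr_ge0// exprMn -ler_pdivrMr// -subr_ge0.
by rewrite -norm_subZ_proj// exprn_ge0.
Qed.

Lemma parallelogram x y :
  `|x + y| ^+ 2 + `|x - y| ^+ 2 = (`|x| ^+ 2 + `|y| ^+ 2) *+ 2.
Proof.
by rewrite -!dotp_norm !dotpBl !dotpDl !dotpBr !dotpDr; ring.
Qed.

Lemma normDZ_sqr x y a : `|x + a *: y| ^+ 2 =
  `|x| ^+ 2 + `|a| ^+ 2 * `|y| ^+ 2 + (a^* * dotp x y + (a^* * dotp x y)^*).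
Proof.
rewrite -!dotp_norm dotpDl !dotpDr !dotpZl !dotpZr (dotpC y x) rmorphM /= conjCK.
by rewrite normCK; ring.
Qed.

Lemma dotpl_continuous y : continuous (dotp^~ y : V -> R[i]^o).
Proof.
move=> x; apply/cvgrPdist_lt => e e0.
have d0 : 0 < e / (`|y| + 1) by rewrite divr_gt0// ltr_wpDl.
have : \forall z \near x, `|x - z| < e / (`|y| + 1).
  by apply/nbhs_ballP; exists (e / (`|y| + 1)) => // z; rewrite -ball_normE.
apply: filterS => z xz; rewrite -dotpBl.
apply: le_lt_trans (cauchy_schwarz _ _) _.
have y1 : 0 < `|y| + 1 by rewrite ltr_wpDl.
apply: (@le_lt_trans _ _ (`|x - z| * (`|y| + 1))).
  by rewrite ler_wpM2l// lerDl.
by rewrite -ltr_pdivlMr.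
Qed.

End InnerProduct.

(** * Orthogonal projection on a closed subspace *)

Section Projection.
Context {R : realType} {V : hilbertType R}.

(** The near-minimizers in [M] of the distance to [v] generate a Cauchy filter, and [m] is its
    limit. Orthogonality holds for near-minimizers up to a small error and passes to the limit. *)
Lemma projection (M : set V) : closed M -> M 0 ->
    (forall a x y, M x -> M y -> M (a *: x + y)) ->
  forall v, exists2 m, M m & forall u, M u -> dotp (v - m) u = 0.
Proof.
move=> clM M0 Mlin v.
(* Norms take values in [R[i]]; the real part allows an infimum in [R]. *)
pose q (x : V) : R := complex.Re (`|v - x| ^+ 2).
have qE x : (q x)%:C%C = `|v - x| ^+ 2.
  by rewrite RRe_real// ger0_real// exprn_ge0.
have q_ge0 x : 0 <= q x by rewrite -lecR qE exprn_ge0.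
pose E := [set q x | x in M]; pose delta := inf E.
have hE : has_inf E.
  by split; [exists (q 0), 0 | exists 0 => _ [x _ <-]].
have le_delta x : M x -> delta <= q x.
  by move=> Mx; apply: ge_inf; [case: hE | exists x].
pose B (e : R) := [set x | M x /\ q x < delta + e].
have nB e : 0 < e -> exists x, B e x.
  by move=> e0; have [_ [x Mx <-] h] := inf_adherent e0 hE; exists x.
pose F := filter_from [set e : R | 0 < e] B.
have FF : ProperFilter F.
  apply: filter_from_proper; last by move=> e /nB.
  apply: filter_from_filter; first by exists 1 => /=.
  move=> e e' e0 e'0; exists (Num.min e e'); first by rewrite /= lt_min e0.
  move=> x [Mx]; rewrite -ltrBlDl lt_min => /andP[? ?].
  by split; split => //; rewrite -ltrBlDl.
(* The midpoint of [x] and [y] lies in [M], so its [q] is at least [delta]; the parallelogram law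
   does the rest. *)
have close e x y : B e x -> B e y -> `|x - y| ^+ 2 <= (4 * e)%:C%C.
  move=> [Mx qx] [My qy].
  have Mz : M ((2^-1 : R[i]) *: (x + y)).
    rewrite -[_ *: _]addr0; apply: (Mlin) => //.
    by rewrite -[x]scale1r; apply: Mlin.
  have h := parallelogram (v - x) (v - y).
  have E1 : `|v - x + (v - y)| ^+ 2 = (4 * q ((2^-1 : R[i]) *: (x + y)))%:C%C.
    rewrite rmorphM /= qE.
    have -> : v - x + (v - y) = (2 : R[i]) *: (v - (2^-1 : R[i]) *: (x + y)).
      rewrite scalerBr scalerA divff ?pnatr_eq0// scale1r scaler_nat mulr2n.
      by rewrite opprD addrACA.
    by rewrite normrZ exprMn normr_nat -natrX rmorph_nat.
  have E2 : v - x - (v - y) = y - x by rewrite opprB addrC addrA subrK.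
  move: h; rewrite E1 E2 (distrC y) -!qE -rmorphD /= addrC.
  move/eqP; rewrite eq_sym -subr_eq -(rmorphMn (real_complex R)).
  rewrite -(rmorphB (real_complex R)) => /eqP <-.
  rewrite lecR; have := le_delta _ Mz; lra.
have cF : cauchy F.
  apply/cauchyP => e e0.
  have eE : e = (complex.Re e)%:C%C by rewrite RRe_real// gtr0_real.
  have r0 : 0 < complex.Re e by rewrite -ltcR -eE.
  set r := complex.Re e in eE r0.
  (* By [close], an excess of [r ^+ 2 / 5] bounds squared distances by four fifths of [r ^+ 2]. *)
  have t0 : 0 < r ^+ 2 / 5 by rewrite divr_gt0// exprn_gt0.
  have [x Bx] := nB _ t0; exists x, (r ^+ 2 / 5) => // y By.
  rewrite -ball_normE /ball_ /= -(@ltr_pXn2r _ 2) ?nnegrE// ?ltW//.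
  apply: le_lt_trans (close _ _ _ Bx By) _.
  rewrite eE -rmorphXn /= ltcR; have := exprn_gt0 2 r0; lra.
have /cauchy_cvg/cvg_ex[/= m Fm] := cF.
have Mm : M m.
  apply: (@closed_cvg _ _ F FF id M clM _ m Fm).
  by exists 1 => //= x [].
exists m => // u Mu.
have [->|u0] := eqVneq u 0; first by rewrite dotp0r.
have nu0 : 0 < `|u| by rewrite normr_gt0.
(* Adding to [x] the best multiple of [u] stays in [M] and lowers [q] by the square of
   [dotp (v - x) u] over that of the norm of [u]; this gain cannot exceed [e]. *)
have small e x : B e x -> `|dotp (v - x) u| ^+ 2 <= e%:C%C * `|u| ^+ 2.
  move=> [Mx qx]; rewrite -ler_pdivrMr ?exprn_gt0//.
  set a := dotp (v - x) u / `|u| ^+ 2.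
  have Ma : M (a *: u + x) by exact: Mlin.
  have := le_delta _ Ma; rewrite -lecR qE (addrC (a *: u)) opprD addrA.
  rewrite norm_subZ_proj//.
  rewrite -qE => h; rewrite -subr_ge0 in h; rewrite -subr_ge0.
  apply: le_trans h _; rewrite addrAC lerD2r lerBlDr -rmorphD /= lecR addrC.
  exact: ltW.
apply/eqP/contraT; rewrite -normr_gt0; set k := `|dotp (v - m) u| => k0.
(* For [x] within [eta] of [m] and with excess below [eta ^+ 2], the parts [v - x] and [x - m] each
   contribute at most [k / 3] to [k], a contradiction. *)
pose eta := k / (3 * `|u|).
have eta0 : 0 < eta by rewrite divr_gt0// mulr_gt0.
have etaE : eta = (complex.Re eta)%:C%C by rewrite RRe_real// gtr0_real.
have t0 : 0 < complex.Re eta by rewrite -ltcR -etaE.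
have Hm : F (ball m eta) := Fm _ (nbhsx_ballx m _ eta0).
have : F (B (complex.Re eta ^+ 2)).
  by exists (complex.Re eta ^+ 2) => //=; rewrite exprn_gt0.
move=> /(filterI Hm)/filter_ex[x [+ /small]]; rewrite -ball_normE /ball_ /= => mx.
rewrite rmorphXn /= -etaE -exprMn ler_pXn2r ?nnegrE
  ?(mulr_ge0 (ltW eta0))// => vx.
have : k < k; last by rewrite ltxx.
rewrite {1}/k (_ : v - m = (v - x) + (x - m)); last by rewrite addrA subrK.
rewrite dotpDl; apply: le_lt_trans (ler_normD _ _) _.
apply: (@le_lt_trans _ _ (eta * `|u| + eta * `|u|)).
  apply: lerD => //; apply: le_trans (cauchy_schwarz _ _) _.
  by rewrite ler_wpM2r// distrC ltW.
have -> : eta * `|u| = k / 3 by rewrite /eta; field; rewrite gt_eqF.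
rewrite -mulrDl ltr_pdivrMr// mulrDr mulr1 ltrD2l.
by rewrite mulrDr mulr1 ltrDl.
Qed.

End Projection.

(** * Riesz representation, adjoints and isometries *)

Section Adjoint.
Context {R : realType}.

Lemma bop_of_linear (X Y : hilbertType R) (f : X -> Y) :
  linear f -> continuous f -> exists T : bop X Y, T =1 f.
Proof.
move=> fl fc.
pose g : {linear X -> Y} := HB.pack f (GRing.isLinear.Build R[i] X Y *:%R f fl).
by exists (@BOp _ _ _ g fc).
Qed.

Lemma closed_zeros (X : hilbertType R) (phi : X -> R[i]^o) :
  continuous phi -> closed [set x | phi x = 0].
Proof.
move=> phic; apply: (closed_comp (f := phi) (D := [set 0])) => [x _|].
  exact: phic.
apply: accessible_closed_set1; apply: hausdorff_accessible.
exact: norm_hausdorff.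
Qed.

(** If [phi v] is nonzero, the component [n] of [v] orthogonal to the kernel of [phi] is nonzero
    too. As [z - (phi z / phi n) *: n] lies in the kernel, a multiple of [n] represents [phi]. *)
Lemma riesz (X : hilbertType R) (phi : X -> R[i]^o) :
  linear phi -> continuous phi -> exists y, forall z, phi z = dotp z y.
Proof.
move=> phil phic.
have [[v phiv]|phi0] := pselect (exists v, phi v != 0); last first.
  exists 0 => z; rewrite dotp0r; apply/eqP/contraT => h.
  by case: phi0; exists z.
have phiZ a z : phi (a *: z) = a * phi z.
  have phi00 : phi 0 = 0.
    by have := phil (-1) 0 0; rewrite scaler0 addr0 scaleN1r addNr.
  by have := phil a z 0; rewrite phi00 !addr0.
have phiD z w : phi (z + w) = phi z + phi w.
  by have := phil 1 z w; rewrite !scale1r.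
have phiB z w : phi (z - w) = phi z - phi w.
  by rewrite phiD -scaleN1r phiZ mulN1r.
pose M := [set z | phi z = 0].
have [||a x y|m Mm mP] := @projection R X M _ _ _ v.
- exact: closed_zeros.
- by rewrite /M /= -(scale0r v) phiZ mul0r.
- by rewrite /M /= phil => -> ->; rewrite addr0 scaler0.
set n := v - m in mP; have phin : phi n != 0 by rewrite phiB Mm subr0.
have n0 : `|n| ^+ 2 != 0.
  rewrite sqrf_eq0 normr_eq0; apply: contra_neq phin => ->.
  by rewrite -(scale0r v) phiZ mul0r.
exists ((phi n / `|n| ^+ 2)^* *: n) => z; rewrite dotpZr conjCK.
have Mz : M (z - (phi z / phi n) *: n).
  by rewrite /M /= phiB phiZ divfK// subrr.
have /(congr1 Num.conj) := mP _ Mz; rewrite -dotpC rmorph0 dotpBl dotpZl dotp_norm.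
move=> /eqP; rewrite subr_eq0 => /eqP->; move: n0; set p := `|n| ^+ 2 => n0.
by field; rewrite n0 phin.
Qed.

Lemma adjoint_exists (X Y : hilbertType R) (T : bop X Y) y :
  exists x, forall z, dotp (T z) y = dotp z x.
Proof.
apply: (@riesz X (fun z => dotp (T z) y)).
  by move=> a z w; rewrite linearP dotpDl dotpZl.
move=> z; apply: (@continuous_comp _ _ _ T (dotp^~ y : Y -> R[i]^o)).
  exact: bop_cont.
exact: dotpl_continuous.
Qed.

(** A relation on bare functions, so that it also covers [opZ], [opA] and [opU], which are not
    packaged as bounded operators. *)
Definition is_adjoint (X Y : hilbertType R) (T : X -> Y) (T' : Y -> X) :=
  forall x y, dotp (T x) y = dotp x (T' y).

Lemma adjointE (X Y : hilbertType R) (T : X -> Y) T' :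
  is_adjoint T T' -> adjoint T = T'.
Proof.
move=> h; apply/funext => y; apply: dotpr_inj => z; rewrite -h.
by rewrite /adjoint; case: xgetP => [x _ /(_ z)//|/(_ (T' y))[]/= z'].
Qed.

Lemma adjointP (X Y : hilbertType R) (T : bop X Y) : is_adjoint T (adjoint T).
Proof.
have [T' h] := choice (adjoint_exists T).
by move=> x y; rewrite (adjointE (T' := T')) => [|? ?]; rewrite h.
Qed.

Lemma opinvE (X Y : hilbertType R) (T : X -> Y) T' :
  cancel T T' -> cancel T' T -> opinv T = T'.
Proof.
move=> TK T'K; apply/funext => y; rewrite /opinv.
by case: xgetP => [x _ /= <-|/(_ (T' y))[]/=]; rewrite ?TK.
Qed.

Lemma is_adjoint_linear (X Y : hilbertType R) (T : X -> Y) T' :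
  is_adjoint T T' -> linear T'.
Proof.
by move=> h a y z; apply: dotpr_inj => x; rewrite dotpDr dotpZr -!h dotpDr dotpZr.
Qed.

(** The squared norm of [T x] is the inner product of [x] with [T' (T x)]; apply Cauchy-Schwarz and
    divide by the norm of [T x]. *)
Lemma contractive_adjoint (X Y : hilbertType R) (T : X -> Y) T' :
  is_adjoint T T' -> contractive T' -> contractive T.
Proof.
move=> h cT' x; have [->|T0] := eqVneq (T x) 0; first by rewrite normr0.
have n0 : 0 < `|T x| by rewrite normr_gt0.
rewrite -(ler_pM2r n0) -expr2 -dotp_norm h.
rewrite -[leLHS]ger0_norm; last by rewrite -h dotp_norm exprn_ge0.
apply: le_trans (cauchy_schwarz _ _) _.
by rewrite ler_wpM2l.
Qed.

(* Polarization, with the coefficient [a] below chosen as the defect of the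
   identity. *)
Lemma isometry_dotp (X Y : hilbertType R) (T : X -> Y) x y : linear T ->
    (forall a, `|T (x + a *: y)| = `|x + a *: y|) -> `|T y| = `|y| ->
  dotp (T x) (T y) = dotp x y.
Proof.
move=> Tl h hy.
have hx : `|T x| = `|x| by have := h 0; rewrite scale0r addr0.
have TE a : T (x + a *: y) = T x + a *: T y by rewrite addrC Tl addrC.
apply/subr0_eq; set t := _ - _; apply/eqP; rewrite -normr_eq0 -sqrf_eq0.
have := congr1 (fun z => z ^+ 2) (h t); rewrite TE !normDZ_sqr hx hy.
move/addrI/eqP; rewrite -subr_eq0 => /eqP E.
have : t^* * t + (t^* * t)^* = 0.
  by rewrite -[RHS]E {2 4}/t !rmorphM !rmorphB /= !conjCK; ring.
rewrite rmorphM /= conjCK mulrC -normCK -mulr2n => /eqP.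
by rewrite mulrn_eq0.
Qed.

End Adjoint.

(** * Unitary operators and families with equal Gram matrices *)

Section Unitary.
Context {R : realType}.

Lemma lipschitz_continuous (X Y : hilbertType R) (f : X -> Y) :
  (forall x y, `|f x - f y| <= `|x - y|) -> continuous f.
Proof.
move=> fl x; apply/cvgrPdist_lt => e e0.
have : \forall y \near x, `|x - y| < e.
  by apply/nbhs_ballP; exists e => // z; rewrite -ball_normE.
by apply: filterS => y; exact: le_lt_trans (fl _ _).
Qed.

Definition bop_comp (X Y Z : hilbertType R) (g : bop Y Z) (f : bop X Y) :
    bop X Z :=
  BOp (bop_fun := GRing.Linear.clone _ _ _ _ (g \o f) _)
    (fun x => continuous_comp (@bop_cont _ _ _ f x) (@bop_cont _ _ _ g (f x))).

Lemma unitary_norm (X Y : hilbertType R) (V : X -> Y) x : unitary V ->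
  `|V x| = `|x|.
Proof.
by case=> Vd _; apply/eqP; rewrite -(@eqrXn2 _ 2)// -!dotp_norm Vd.
Qed.

(** Surjectivity gives a right inverse; preservation of inner products makes it two-sided, linear
    and isometric. *)
Lemma unitary_inverse (X Y : hilbertType R) (V : bop X Y) : unitary V ->
  exists W : bop Y X, [/\ unitary W, cancel V W & cancel W V].
Proof.
move=> Vu; have [Vd Vs] := Vu; have [W WK] := choice Vs.
have Wd y y' : dotp (W y) (W y') = dotp y y' by rewrite -Vd !WK.
have VK : cancel V W by move=> x; apply: dotpl_inj => z; rewrite -Vd WK.
have Wl : linear W by move=> a y z; rewrite -{1}(WK y) -{1}(WK z) -linearP VK.
have Wc : continuous W.
  apply: lipschitz_continuous => y z.
  have -> : W y - W z = W (y - z) by rewrite addrC -scaleN1r -Wl scaleN1r addrC.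
  rewrite (_ : `|W (y - z)| = `|y - z|)//.
  by apply: unitary_norm; split=> // x; exists (V x).
have [T TW] := bop_of_linear Wl Wc; exists T.
have -> : (T : Y -> X) = W by exact/funext.
by split=> //; split=> // x; exists (V x).
Qed.

(* The pairs [(x, q)] sought form a closed subspace [M] of the direct sum; since
   every [(g i, k i)] lies in [M], the orthogonal projection of [(x + x, 0)]
   on [M] is [(x, q)]. *)
Lemma gram_correspondence (I : Type) (X Y : hilbertType R)
    (g : I -> X) (k : I -> Y) :
    (forall i j, dotp (g i) (g j) = dotp (k i) (k j)) ->
    (forall x, (forall i, dotp x (g i) = 0) -> x = 0) ->
  forall x, exists2 q, `|q| = `|x| & forall i, dotp q (k i) = dotp x (g i).
Proof.
move=> gk gtot x.
pose M := [set v : dsum X Y | forall i, dotp v ((g i, - k i) : dsum X Y) = 0].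
have ME v : M v <-> forall i, dotp v.1 (g i) = dotp v.2 (k i).
  split=> h i; have := h i; rewrite dsum_dotE /= dotpNr.
    by move=> /eqP; rewrite subr_eq0 => /eqP.
  by move=> ->; rewrite subrr.
have [|i|a v w Mv Mw i|[p q] /ME/= Mm mP] :=
    @projection R (dsum X Y) M _ _ _ ((x + x, 0) : dsum X Y).
- rewrite (_ : M = \bigcap_(i in setT)
      ((fun v : dsum X Y => dotp v ((g i, - k i) : dsum X Y)) @^-1` [set 0])).
    apply: closed_bigI => i _.
    by apply: closed_zeros; exact: dotpl_continuous.
  by apply/seteqP; split=> v h i; [move=> _; exact: h | exact: h].
- by rewrite dotp0l.
- by rewrite dotpDl dotpZl Mv Mw mulr0 addr0.
(* Pairing the residual [(x + x - p, - q)] with [(g i, k i)] shows that [(x - p) + (x - p)] is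
   orthogonal to every [g i]. *)
have px : p = x.
  have : (x - p) + (x - p) = 0.
    apply: gtot => i; have /mP : M (g i, k i) by apply/ME => j /=; rewrite gk.
    rewrite dsum_dotE /= sub0r dotpNl -Mm -dotpBl => <-.
    by congr dotp; rewrite addrACA addrA.
  move=> /eqP; rewrite -mulr2n -scaler_nat scaler_eq0 pnatr_eq0 /= subr_eq0.
  by move=> /eqP.
exists q; last by move=> i; rewrite -Mm px.
(* The residual, now [(x, - q)], is orthogonal to [(x, q)], which equates the norms. *)
have /mP : M (p, q) by apply/ME.
rewrite dsum_dotE /= px addrK sub0r dotpNl !dotp_norm => /eqP.
by rewrite subr_eq0 eqrXn2// => /eqP.
Qed.

(** Totality of [k] makes the vector matched with [x] unique, hence linear in [x]. Surjectivity is
    the same correspondence with [g] and [k] exchanged. *)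
Lemma gram_unitary (I : Type) (X Y : hilbertType R) (g : I -> X) (k : I -> Y) :
    (forall i j, dotp (g i) (g j) = dotp (k i) (k j)) ->
    (forall x, (forall i, dotp x (g i) = 0) -> x = 0) ->
    (forall y, (forall i, dotp y (k i) = 0) -> y = 0) ->
  exists2 V : bop X Y, unitary V & forall x i, dotp (V x) (k i) = dotp x (g i).
Proof.
move=> gk gtot ktot.
have kinj y y' : (forall i, dotp y (k i) = dotp y' (k i)) -> y = y'.
  by move=> h; apply/subr0_eq/ktot => i; rewrite dotpBl h subrr.
have [F F1 F2] := all_sig2 (fun x => cid2 (gram_correspondence gk gtot x)).
have Fl : linear F.
  by move=> a x y; apply: kinj => i; rewrite dotpDl dotpZl !F2 dotpDl dotpZl.
have Fc : continuous F.
  apply: lipschitz_continuous => x y.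
  have -> : F x - F y = F (x - y) by rewrite addrC -scaleN1r -Fl scaleN1r addrC.
  by rewrite F1.
have [V VF] := bop_of_linear Fl Fc; exists V; last by move=> x i; rewrite VF F2.
split=> [x x'|y].
  by rewrite !VF; apply: isometry_dotp.
have [x _ xP] := gram_correspondence (fun i j => esym (gk i j)) ktot y.
by exists x; rewrite VF; apply: kinj => i; rewrite F2 xP.
Qed.

End Unitary.

(** * Observability functions, the defect space and the Gram identity *)

Section Colligation.
Context {R : realType} {d : nat} {U Y : hilbertType R}.

Definition opZs (X : hilbertType R) (l : cball R d) (x : X) : dpow d X :=
  [ffun j => (val l 0 j)^* *: x].

(** The function of [l] attached to the state [x]; the state written g_(l,y) in the opening comment
    is [adjoint (observ c l) y]. *)
Definition observ (X : hilbertType R) (c : colligation d X U Y) l (x : X) : Y :=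
  colC c (opinv (pencil c l) x).

Lemma cdot_lt1 (l z : cball R d) : `|cdot (val l) (val z)| < 1.
Proof.
pose v (l : cball R d) : dpow d R[i]^o := [ffun j => val l 0 j].
have vE l' z' : dotp (v l') (v z') = cdot (val l') (val z').
  by rewrite dpow_dotE; apply: eq_bigr => j _; rewrite !ffunE.
have v1 l' : `|v l'| < 1.
  by rewrite -(@ltr_pXn2r _ 2) ?nnegrE// expr1n -dotp_norm vE (valP l').
rewrite -vE; apply: le_lt_trans (cauchy_schwarz _ _) _.
by rewrite mulr_ilt1.
Qed.

(** Supplies the combinations to which polarization applies the isometry hypothesis. *)
Lemma span_addZ (V : hilbertType R) (A : set V) a x y : A x -> A y ->
  Defs.span A (x + a *: y).
Proof.
move=> Ax Ay; exists 2, (fun i => if i == 0 then 1 else a),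
  (fun i => if i == 0 then x else y); split=> [i|]; first by case: ifP.
by rewrite !big_ord_recl big_ord0 /= scale1r addr0.
Qed.

Section OneColligation.
Context {X : hilbertType R}.
Implicit Types (c : colligation d X U Y) (l z : cball R d).

Lemma opZ_linear l : linear (opZ l : dpow d X -> X).
Proof.
move=> a v w; rewrite /opZ scaler_sumr -big_split /=; apply: eq_bigr => j _.
by rewrite !ffunE scalerDr !scalerA mulrC.
Qed.

Lemma opZ_adjoint l : is_adjoint (opZ l : dpow d X -> X) (opZs l).
Proof.
move=> v x; rewrite dotp_suml dpow_dotE; apply: eq_bigr => j _.
by rewrite ffunE dotpZl dotpZr conjCK.
Qed.

Lemma opA_adjoint c :
  is_adjoint (opA c) (fun v => \sum_j adjoint (colA c j) (v j)).
Proof.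
move=> x v; rewrite dotp_sumr dpow_dotE; apply: eq_bigr => j _.
by rewrite ffunE adjointP.
Qed.

Lemma opB_adjoint c :
  is_adjoint (opB c) (fun v => \sum_j adjoint (colB c j) (v j)).
Proof.
move=> x v; rewrite dotp_sumr dpow_dotE; apply: eq_bigr => j _.
by rewrite ffunE adjointP.
Qed.

(** The transposed block matrix of the adjoints of the entries is an adjoint, and [adjointE]
    identifies it with the chosen one. *)
Lemma opU_adjoint c : is_adjoint (opU c) (adjoint (opU c)).
Proof.
suff [T' h] : exists T', is_adjoint (opU c) T' by rewrite (adjointE h).
exists (fun w => (adjoint (opA c) w.1 + adjoint (colC c) w.2,
                  adjoint (opB c) w.1 + adjoint (colD c) w.2)).
move=> [x u] [v y]; rewrite !dsum_dotE /= !dotpDl !dotpDr.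
rewrite (adjointE (opA_adjoint c)) (adjointE (opB_adjoint c)).
by rewrite -opA_adjoint -opB_adjoint -!adjointP addrACA.
Qed.

Lemma opinv_pencil c l : invertible (pencil c l) ->
  exists T : bop X X,
    [/\ opinv (pencil c l) = T, cancel (pencil c l) T & cancel T (pencil c l)].
Proof. by case=> T [PT TP]; exists T; rewrite (opinvE PT TP). Qed.

Lemma observ_linear c l : invertible (pencil c l) -> linear (observ c l).
Proof. by case/opinv_pencil => T [TE _ _] a x y; rewrite /observ TE !linearP. Qed.

Lemma observ_adjoint c l : invertible (pencil c l) ->
  is_adjoint (observ c l) (adjoint (observ c l)).
Proof.
case/opinv_pencil => T [TE _ _].
suff [T' h] : exists T', is_adjoint (observ c l) T' by rewrite (adjointE h).
exists (adjoint T \o adjoint (colC c)) => x y.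
by rewrite /observ TE adjointP adjointP.
Qed.

Lemma observ0 c x : observ c cball0 x = colC c x.
Proof.
have Z0 v : opZ cball0 v = 0 :> X.
  by rewrite /opZ big1// => j _; rewrite mxE scale0r.
have PE : pencil c cball0 = id.
  by apply/funext => x'; rewrite /pencil Z0 subr0.
by rewrite /observ PE (@opinvE _ _ _ id id).
Qed.

(** This is (I - ZA)^-1 = I + (I - ZA)^-1 ZA followed by [C]; it becomes the Gleason identity in the
    model. *)
Lemma observ_resolvent c l x : invertible (pencil c l) ->
  observ c l x = colC c x + observ c l (opZ l (opA c x)).
Proof.
case/opinv_pencil => T [TE PT _]; rewrite /observ TE -{2}(PT x) -linearD.
by rewrite -linearD /pencil subrK.
Qed.

(** The map inverted on the left is the adjoint of the pencil, so its inverse is the adjoint of the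
    inverse of the pencil. *)
Lemma defect_vectorE c z y : invertible (pencil c z) ->
  adjoint (opZ z) (opinv (fun x => x - adjoint (opA c) (adjoint (opZ z) x))
    (adjoint (colC c) y)) = opZs z (adjoint (observ c z) y).
Proof.
move=> inv; have [T [TE PT TP]] := opinv_pencil inv; set Q := fun x => _.
have PQ : is_adjoint (pencil c z) Q.
  move=> x x'; rewrite /pencil dotpBl dotpBr opZ_adjoint.
  by rewrite (adjointE (opA_adjoint c)) -opA_adjoint (adjointE (opZ_adjoint z)).
rewrite (adjointE (opZ_adjoint z)); congr opZs.
rewrite (@opinvE _ _ _ Q (adjoint T)) => [|x|x]; last first.
- by apply: dotpr_inj => x'; rewrite -PQ -adjointP PT.
- by apply: dotpr_inj => x'; rewrite -adjointP -PQ TP.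
by apply: dotpr_inj => x; rewrite -observ_adjoint// -!adjointP /observ TE.
Qed.

Lemma defect_spaceE c : (forall l, invertible (pencil c l)) ->
  defect_space c = closed_span
    [set v | exists z y, v = opZs z (adjoint (observ c z) y)].
Proof.
move=> inv; congr closed_span; apply/seteqP.
by split=> v [z [y ->]]; exists z, y; rewrite defect_vectorE.
Qed.

Context (S : cball R d -> bop U Y) (c : colligation d X U Y).
Context (cS : realizes c S).

(** Pair with [(x, u)] and move all adjoints across: [observ_resolvent] collects the terms in [x],
    and the transfer function formula those in [u]. *)
Lemma adjoint_opU_defect z y :
  adjoint (opU c) (opZs z (adjoint (observ c z) y), y) =
  (adjoint (observ c z) y, adjoint (S z) y).
Proof.
have [inv SE] := cS z.
apply: dotpr_inj => -[x u]; rewrite -opU_adjoint !dsum_dotE /=.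
rewrite -opZ_adjoint -observ_adjoint// -observ_adjoint// -adjointP SE.
rewrite -!dotpDl (observ_resolvent x inv); congr dotp.
have -> : opZ z (opA c x + opB c u) = opZ z (opA c x) + opZ z (opB c u).
  have := opZ_linear z 1 (opA c x) (opB c u). rewrite !scale1r => h. exact: h.
have := observ_linear inv 1 (opZ z (opA c x)) (opZ z (opB c u)).
by rewrite !scale1r => ->; rewrite [LHS]addrC addrACA.
Qed.

(** Weak coisometry only equates norms, so polarization is needed to equate inner products. The
    factors from [opZs] contribute <w,z> times the left-hand side, and 1 - <w,z> is invertible by
    [cdot_lt1]. *)
Lemma weakly_coisometric_gram : weakly_coisometric c -> forall z y w y',
  dotp (adjoint (observ c z) y) (adjoint (observ c w) y') =
  dotp (KS S w z y) y'.
Proof.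
move=> [_ iso] z y w y'.
have inv l : invertible (pencil c l) by case: (cS l).
rewrite defect_spaceE// in iso.
pose g l y := opZs l (adjoint (observ c l) y).
pose v : dsum (dpow d X) Y := (g z y, y).
pose v' : dsum (dpow d X) Y := (g w y', y').
have : dotp (adjoint (opU c) v) (adjoint (opU c) v') = dotp v v'.
  apply: isometry_dotp => [|a|].
  - exact: (is_adjoint_linear (opU_adjoint c)).
  - apply: iso; apply: subset_closure.
    by apply: span_addZ; [exists z, y | exists w, y'].
  (* A single generator is put in the form required by [span_addZ] with coefficient 0. *)
  - apply: iso; apply: subset_closure; rewrite -[g w y']addr0 -(scale0r (g w y')).
    by apply: span_addZ; exists w, y'.
rewrite !adjoint_opU_defect !dsum_dotE /= => E.
have ZZ : dotp (g z y) (g w y') = cdot (val w) (val z) *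
    dotp (adjoint (observ c z) y) (adjoint (observ c w) y').
  rewrite dpow_dotE mulr_suml; apply: eq_bigr => j _.
  by rewrite !ffunE dotpZl dotpZr conjCK mulrA (mulrC (_^*)).
rewrite /KS dotpZl dotpBl adjointP.
set p := cdot _ _ in ZZ *; have p1 : 1 - p != 0.
  rewrite subr_eq0 eq_sym; apply: contraTneq (cdot_lt1 w z); rewrite -/p => ->.
  by rewrite normr1 ltxx.
apply: (mulfI p1); rewrite mulVKf// mulrBl mul1r -ZZ.
by apply/eqP; rewrite subr_eq addrAC -subr_eq opprK E addrC.
Qed.

Lemma observable_total : observable c ->
  forall x, (forall z y, dotp x (adjoint (observ c z) y) = 0) -> x = 0.
Proof.
move=> obs x h; apply: obs => z; apply: dotpl_inj => y.
by rewrite dotp0l -(h z y) -observ_adjoint//; case: (cS z).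
Qed.

End OneColligation.

(** * Transport of a colligation along a unitary *)

Section Transport.
Context {X X' : hilbertType R} (V : bop X X').
Context (c : colligation d X U Y) (c' : colligation d X' U Y).
Context (Vu : unitary V).
Context (VA : forall j x, colA c' j (V x) = V (colA c j x)).
Context (VB : forall j u, colB c' j u = V (colB c j u)).
Context (VC : forall x, colC c' (V x) = colC c x).
Context (VD : forall u, colD c' u = colD c u).

Lemma opU_transport (v : dsum X U) :
  dsum_map (dpow_map V) idfun (opU c v) = opU c' (dsum_map V idfun v).
Proof.
rewrite /dsum_map /opU /= VC VD; congr pair.
by apply/ffunP => j; rewrite !ffunE VA VB linearD.
Qed.

Lemma opZ_transport (l : cball R d) (v : dpow d X) :
  opZ l (dpow_map V v) = V (opZ l v).
Proof.
by rewrite /opZ linear_sum; apply: eq_bigr => j _; rewrite ffunE linearZ.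
Qed.

Lemma opA_transport x : opA c' (V x) = dpow_map V (opA c x).
Proof. by apply/ffunP => j; rewrite !ffunE VA. Qed.

Lemma opB_transport u : opB c' u = dpow_map V (opB c u).
Proof. by apply/ffunP => j; rewrite !ffunE VB. Qed.

Lemma pencil_transport l x : pencil c' l (V x) = V (pencil c l x).
Proof. by rewrite /pencil opA_transport opZ_transport linearB. Qed.

Lemma invertible_transport l : invertible (pencil c l) ->
  invertible (pencil c' l).
Proof.
case=> T [PT TP]; have [W [_ VW WV]] := unitary_inverse Vu.
exists (bop_comp V (bop_comp T W)); split=> x /=.
  by rewrite -[x]WV pencil_transport !VW PT.
by rewrite pencil_transport TP WV.
Qed.

Lemma observ_transport l x : invertible (pencil c l) ->
  observ c' l (V x) = observ c l x.
Proof.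
move=> inv; have [T' [T'E P'T' _]] := opinv_pencil (invertible_transport inv).
have [T [TE _ TP]] := opinv_pencil inv.
by rewrite /observ TE T'E -[in LHS](TP x) -pencil_transport P'T' VC.
Qed.

Lemma realizes_transport S : realizes c S -> realizes c' S.
Proof.
move=> cS l; have [inv SE] := cS l; split; first exact: invertible_transport.
move=> u; rewrite SE VD; congr (_ + _).
by rewrite opB_transport opZ_transport -!/(observ _ _ _) observ_transport.
Qed.

(** The adjoint of the new colligation is the old one composed with isometries built from [V] and
    its inverse [W]. Coordinatewise, [W] sends the defect generators of [c'] to those of [c], and by
    continuity the closed span into the closed span. *)
Lemma weakly_coisometric_transport S : realizes c S ->
  weakly_coisometric c -> weakly_coisometric c'.
Proof.
move=> cS [ctr iso]; have [W [Wu VW WV]] := unitary_inverse Vu.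
have inv l : invertible (pencil c l) by case: (cS l).
have normV := unitary_norm _ Vu; have normW := unitary_norm _ Wu.
have adjE (w : dsum (dpow d X') Y) : adjoint (opU c') w =
    dsum_map V idfun (adjoint (opU c) (dsum_map (dpow_map W) idfun w)).
  apply: dotpr_inj => -[x u]; rewrite -opU_adjoint -[x]WV.
  have := opU_transport (W x, u); rewrite /dsum_map /= => <-.
  have [Vd _] := Vu.
  rewrite [RHS]dsum_dotE /= Vd -[RHS](dsum_dotE ((W x, u) : dsum _ _)) -opU_adjoint.
  rewrite !dsum_dotE /=; congr (_ + _); rewrite !dpow_dotE.
  by apply: eq_bigr => j _; rewrite !ffunE -Vd WV.
have nV (v : dsum X U) : `|dsum_map V idfun v : dsum X' U| = `|v|.
  by apply/eqP; rewrite -(@eqrXn2 _ 2)// !dsum_normE /= normV.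
have nW v : `|dpow_map W v : dpow d X| = `|v|.
  apply/eqP; rewrite -(@eqrXn2 _ 2)// !dpow_normE.
  by apply/eqP; apply: eq_bigr => j _; rewrite ffunE normW.
have nWY (v : dsum (dpow d X') Y) :
    `|dsum_map (dpow_map W) idfun v : dsum (dpow d X) Y| = `|v|.
  by apply/eqP; rewrite -(@eqrXn2 _ 2)// !dsum_normE /= nW.
have Wl : linear (dpow_map W : dpow d X' -> dpow d X).
  by move=> a v w; apply/ffunP => j; rewrite !ffunE linearP.
split=> [w|v y vD]; first by rewrite adjE nV -nWY; exact: ctr.
rewrite adjE nV iso; first by rewrite -[RHS]nWY.
rewrite defect_spaceE// in vD; last by move=> l; exact: invertible_transport.
rewrite defect_spaceE//.
have Wc : continuous (dpow_map W : dpow d X' -> dpow d X).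
  apply: lipschitz_continuous => v1 v2.
  have -> : dpow_map W v1 - dpow_map W v2 = dpow_map W (v1 - v2).
    by rewrite [LHS]addrC -scaleN1r -Wl scaleN1r addrC.
  by rewrite nW.
have gen z y1 : dpow_map W (opZs z (adjoint (observ c' z) y1)) =
    opZs z (adjoint (observ c z) y1).
  apply/ffunP => j; rewrite !ffunE linearZ; congr (_ *: _).
  apply: dotpr_inj => x; have [Vd _] := Vu.
  rewrite -observ_adjoint// -Vd WV -observ_adjoint ?observ_transport//.
  exact: invertible_transport.
(* The preimage of the neighbourhood [B] is a neighbourhood of [v], so it contains a combination of
   generators, whose image lies in [B]. *)
move=> B /Wc /vD [_ [[n [a [b [bP ->]]]] Bv]].
exists (dpow_map W (\sum_(i < n) a i *: b i)); split=> //.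
exists n, a, (fun i => dpow_map W (b i)); split.
  by move=> i; have [z [y1 ->]] := bP i; exists z, y1; rewrite gen.
apply/ffunP => j; rewrite ffunE !sum_ffunE linear_sum; apply: eq_bigr => i _.
by rewrite !ffunE linearZ.
Qed.

End Transport.

(** * Kernel functions of the model space *)

Section ModelSpace.
Context {S : cball R d -> bop U Y} (H : rkhs (KS S)).

Lemma rkhs_kernels : exists k : cball R d * Y -> H,
  [/\ forall zy zy', dotp (k zy) (k zy') = dotp (KS S zy'.1 zy.1 zy.2) zy'.2,
      forall f, (forall zy, dotp f (k zy) = 0) -> f = 0 &
      forall f zy, dotp f (k zy) = dotp (rk_eval f zy.1) zy.2].
Proof.
have [k kP] := choice (fun zy : cball R d * Y => rk_kernel H zy.1 zy.2).
have kdot f zy : dotp f (k zy) = dotp (rk_eval f zy.1) zy.2.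
  by case: (kP zy) => _ ->.
exists k; split=> // [zy zy'|f f0]; first by rewrite kdot; case: (kP zy) => ->.
apply: (@rk_eval_inj _ _ _ _ H); apply/funext => z.
apply: dotpl_inj => y; rewrite -(kdot f (z, y)) f0.
(* The zero vector evaluates to 0, by cancellation in the additivity of evaluation. *)
have := rk_evalP 1 (0 : H) 0 z; rewrite !scale1r addr0 -{1}[rk_eval _ _]addr0.
by move/addrI <-; rewrite dotp0l.
Qed.

End ModelSpace.
End Colligation.

(** * Construction of the functional model *)

Theorem theorem3p4 (R : realType) (d : nat) (U Y : hilbertType R)
    (S : cball R d -> bop U Y) (hS : schur_class S)
    (X : hilbertType R) (c : colligation d X U Y)
    (hreal : realizes c S) (hwc : weakly_coisometric c) (hobs : observable c)
    (H : rkhs (KS S)) :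
  exists c' : colligation d H U Y,
    gen_functional_model c' /\ unitarily_equivalent c c'.
Proof.
have inv l : invertible (pencil c l) by case: (hreal l).
have [k [kk ktot kdot]] := rkhs_kernels H.
pose g (zy : cball R d * Y) := adjoint (observ c zy.1) zy.2.
have [|x x0||V Vu Vg] := @gram_unitary _ _ X H g k.
- by move=> zy zy'; rewrite kk -(weakly_coisometric_gram hreal hwc).
- by apply: (observable_total hreal hobs) => z y; exact: (x0 (z, y)).
- exact: ktot.
have Vobs x l : rk_eval (V x) l = observ c l x.
  apply: dotpl_inj => y.
  by rewrite -(kdot (V x) (l, y)) Vg -observ_adjoint.
have [W [Wu VW WV]] := unitary_inverse Vu.
(* The entries are those forced by unitary equivalence through [V]. *)
pose c' : colligation d H U Y := Colligation
  (fun j => bop_comp V (bop_comp (colA c j) W)) (fun j => bop_comp V (colB c j))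
  (bop_comp (colC c) W) (colD c).
have VA j x : colA c' j (V x) = V (colA c j x) by rewrite /= VW.
have VC x : colC c' (V x) = colC c x by rewrite /= VW.
exists c'; split; last by exists V; split=> // v; exact: opU_transport.
split.
- exact: (realizes_transport Vu).
- exact: (weakly_coisometric_transport Vu _ _ _ _ hreal).
- by move=> f; rewrite -[f]WV Vobs observ0 VC.
move=> f; rewrite -[f]WV; set x := W f; split=> [l|].
  rewrite !Vobs observ0 (observ_resolvent x (inv l)) addrC addKr.
  have ol := observ_linear (inv l).
  pose o : {linear X -> Y} := HB.pack (observ c l)
    (GRing.isLinear.Build R[i] X Y *:%R _ ol).
  rewrite -[observ c l]/(o : X -> Y) linear_sum; apply: eq_bigr => j _.
  by rewrite linearZ ffunE VA Vobs.
(* The colligation is contractive because its adjoint is; at [(x, 0)] this is the norm inequality of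
   the Gleason problem. *)
have ctrx : `|opA c x| ^+ 2 + `|colC c x| ^+ 2 <= `|x| ^+ 2.
  have [ctr _] := hwc; have := contractive_adjoint (opU_adjoint c) ctr (x, 0).
  rewrite -(@ler_pXn2r _ 2) ?nnegrE// !dsum_normE /= normr0 expr0n addr0.
  rewrite linear0 addr0 (_ : opB c 0 = 0) ?addr0//.
  by apply/ffunP => j; rewrite !ffunE linear0.
rewrite Vobs observ0 (unitary_norm _ Vu) lerBrDr; apply: le_trans ctrx.
rewrite lerD2r dpow_normE; apply: ler_sum => j _.
by rewrite VA (unitary_norm _ Vu) ffunE.
Qed.
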